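(* Let $N$ be a smooth compact connected manifold, Riemannian-embedded in a matrix algebra $\mathcal M$ (with $0\in N$). Then the space $L^2(S^1,N)$ is contractible.
   Context: $\mathcal M$ is an algebra of complex matrices with Hermitian product $(A,B)\mapsto \mathrm{tr}(AB^* )$, $S^1=\mathbb R/\mathbb Z$. $L^2(S^1,N)$ is the closure of $C^\infty(S^1,N)$ in $L^2(S^1,\mathcal M)$, with the topology of the $L^2$-norm. *)

(* Defs.v *)
From HB Require Import structures.
From mathcomp Require Import all_boot all_order all_algebra.
From mathcomp Require Import all_classical all_reals all_analysis.
Set Implicit Arguments. Unset Strict Implicit. Unset Printing Implicit Defensive.
Import Order.TTheory GRing.Theory Num.Theory.
Import numFieldNormedType.Exports.
Local Open Scope classical_set_scope.
Local Open Scope ring_scope.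

Section Defs.
Variable R : realType.

Fixpoint iterD (V W : normedModType R) (vs : seq V) (f : V -> W) : V -> W :=
  if vs is v :: vs' then (fun x => 'D_v (iterD vs' f) x) else f.

Definition smooth_on (V W : normedModType R) (U : set V) (f : V -> W) :=
  forall vs : seq V,
    (forall x, U x -> {for x, continuous (iterD vs f)}) /\
    (forall x v, U x -> derivable (iterD vs f) x v).

(** Complex n x n matrices, realified: A = (Re A, Im A). *)
Definition cmx (n : nat) := ('M[R]_n * 'M[R]_n)%type.

Definition rdim (n : nat) := (n * n + n * n)%N.

Definition slice (d k : nat) : set 'rV[R]_d :=
  [set y | forall i : 'I_d, (k <= i)%N -> y ord0 i = 0].

Definition smooth_submanifold (n k : nat) (N : set (cmx n)) :=
  forall p, N p -> exists (U : set (cmx n)) (W : set 'rV[R]_(rdim n))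
    (phi : cmx n -> 'rV[R]_(rdim n)) (psi : 'rV[R]_(rdim n) -> cmx n),
    [/\ open U, U p, open W, smooth_on U phi & smooth_on W psi] /\
    [/\ (forall x, U x -> W (phi x) /\ psi (phi x) = x),
        (forall y, W y -> U (psi y) /\ phi (psi y) = y) &
        (forall x, U x -> (N x <-> @slice (rdim n) k (phi x)))].

(** Squared Hilbert-Schmidt norm tr(A A^H) = sum |a_ij|^2 *)
Definition hs2 (n : nat) (A : cmx n) : R :=
  \sum_(i < n) \sum_(j < n) (A.1 i j ^+ 2 + A.2 i j ^+ 2).

(** Maps S^1 = R/Z -> M are 1-periodic maps R -> M. *)
Definition periodic1 (n : nat) (f : R -> cmx n) := forall t, f (t + 1) = f t.

Definition smooth_loop (n : nat) (N : set (cmx n)) (g : R -> cmx n) :=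
  [/\ periodic1 g, smooth_on setT g & forall t, N (g t)].

Definition L2 (n : nat) (f : R -> cmx n) :=
  [/\ periodic1 f,
      (forall i j, measurable_fun setT (fun t => (f t).1 i j) /\
                   measurable_fun setT (fun t => (f t).2 i j)) &
      (\int[lebesgue_measure]_(t in `[0%R, 1%R]) (hs2 (f t))%:E < +oo)%E].

Definition L2dist (n : nat) (f g : R -> cmx n) : R :=
  Num.sqrt (fine (\int[lebesgue_measure]_(t in `[0%R, 1%R]) (hs2 (f t - g t))%:E)).

Definition L2N (n : nat) (N : set (cmx n)) (f : R -> cmx n) :=
  L2 f /\ forall e : R, 0 < e -> exists g, smooth_loop N g /\ L2dist f g < e.

Definition L2_contractible (n : nat) (X : set (R -> cmx n)) :=
  exists (H : R -> (R -> cmx n) -> (R -> cmx n)) (c : R -> cmx n),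
    [/\ X c,
        (forall t f, 0 <= t <= 1 -> X f -> X (H t f)),
        (forall f, X f -> H 0 f = f),
        (forall f, X f -> H 1 f = c) &
        (forall t f, 0 <= t <= 1 -> X f -> forall e : R, 0 < e ->
           exists2 d : R, 0 < d & forall s g, 0 <= s <= 1 -> X g ->
             `|s - t| < d -> L2dist g f < d -> L2dist (H s g) (H t f) < e)].

End Defs.

(* Main.v *)
Require Import Defs.
From HB Require Import structures.
From mathcomp Require Import all_boot all_order all_algebra.
From mathcomp Require Import all_classical all_reals all_analysis.
From mathcomp Require Import measurable_realfun ring lra.
Set Implicit Arguments. Unset Strict Implicit. Unset Printing Implicit Defensive.
Import Order.TTheory GRing.Theory Num.Theory.
Import numFieldNormedType.Exports.
Local Open Scope classical_set_scope.
Local Open Scope ring_scope.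

(** The contraction cuts a loop off: [H t f] is [0] on [[0, t[] and [f] on
    [[t, 1[].  It is jointly continuous because the squared norm of [f] over a
    short interval is small, as one sees by comparing [f] with a smooth, hence
    bounded, loop in [N].  It preserves the closure of the smooth loops: if [g]
    is a smooth loop in [N], smooth paths in [N] from [0] to [g (t + d/2)] and
    from [g (1 - 3d/2)] to [0], run through in time less than [d], turn the cut
    loop into a smooth one, at the cost of an [L2] error that is [O(d)] because
    [N] is bounded.  Such paths exist since the set of points reachable from [0]
    is open and closed in the connected set [N], and they are concatenated
    smoothly after a reparametrisation by a flat step function. *)

(** * Smooth functions of one real variable *)

Section OneVariable.
Variables (R : realType) (V : normedModType R).
Implicit Types (f g : R -> V) (U : set R) (k : nat).

(** The difference quotient splits as [c (x + h)] times the quotient of [f] plus the quotient of [c]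
    times [f x]; continuity of [c] at [x] gives the first limit. *)
Lemma is_derive_scale (c : R -> R) f (x c' : R) (f' : V) :
  is_derive x 1 c c' -> is_derive x 1 f f' ->
  is_derive x 1 (fun y => c y *: f y) (c x *: f' + c' *: f x).
Proof.
move=> [dc cE] [df fE].
have lim_prod : h^-1 *: (((fun y => c y *: f y) \o shift x) (h *: (1 : R))
    - c x *: f x) @[h --> 0^'] --> c x *: f' + c' *: f x.
  rewrite [X in X @ _](_ : _ = fun h => c (h *: (1 : R) + x) *:
      (h^-1 *: ((f \o shift x) (h *: (1 : R)) - f x)) +
      (h^-1 *: ((c \o shift x) (h *: (1 : R)) - c x)) *: f x); last first.
    apply/funext => h /=.
    rewrite [in RHS]scalerA mulrC -!scalerA -scalerDr; congr (_ *: _).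
    by rewrite scalerBr scalerBl addrA subrK.
  apply: cvgD; last by apply: cvgZr_tmp; rewrite -cE; exact: dc.
  apply: cvgZ; last by rewrite -fE; exact: df.
  suff : {for 0, continuous (fun h : R => c (h *: (1 : R) + x))}.
    by move=> /continuous_withinNx; rewrite scale0r add0r.
  exact/differentiable_continuous/derivable1_diffP/(derivable1P _ _ _).1.
apply: DeriveDef; first by apply/cvg_ex; exists (c x *: f' + c' *: f x).
exact: cvg_lim lim_prod.
Qed.

Lemma is_derive_comp1 f (th : R -> R) (x th' : R) (f' : V) :
  is_derive x 1 th th' -> is_derive (th x) 1 f f' ->
  is_derive x 1 (f \o th) (th' *: f').
Proof.
move=> [/derivable1_diffP dth <-] [/derivable1_diffP df <-].
have dc : differentiable (f \o th) x by exact: differentiable_comp.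
apply: DeriveDef; first exact/derivable1_diffP.
apply: eq_trans (deriveE _ dc) _.
apply: eq_trans (congr1 (fun g : R -> V => g 1) (diff_comp dth df)) _.
rewrite /= -[X in 'd f _ X = _]mulr1 [LHS]linearZ.
by congr (_ *: _); apply/esym; [exact: deriveE dth|exact: deriveE df].
Qed.

(* [k]-fold differentiability only: continuity of the last derivative is not
   asked for. *)
Fixpoint Ck k U f : Prop :=
  if k is k'.+1 then (forall x, U x -> derivable f x 1) /\ Ck k' U ('D_1 f)
  else True.

Lemma Ck_eq k U f g : open U -> (forall x, U x -> f x = g x) ->
  Ck k U f -> Ck k U g.
Proof.
move=> oU; elim: k f g => //= k IHk f g fg [df Cf].
have nfg x : U x -> \near x, f x = g x.
  by move=> Ux; near=> y; apply: fg; near: y; exact: open_nbhs_nbhs.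
split=> [x Ux|]; first by apply: near_eq_derivable (df _ Ux); exact: nfg.
by apply: IHk Cf => x Ux; apply: near_eq_derive; exact: nfg.
Unshelve. all: by end_near. Qed.

Lemma Ck_pred k U f : Ck k.+1 U f -> Ck k U f.
Proof. by elim: k f => //= k IHk f [df] /IHk. Qed.

Lemma Ck_subset k U U' f : U' `<=` U -> Ck k U f -> Ck k U' f.
Proof.
move=> UU'; elim: k f => //= k IHk f [df /IHk Cf]; split=> // x /UU'.
exact: df.
Qed.

Lemma Ck_local k U f :
  (forall x, U x -> exists W g, [/\ open W, W x, Ck k W g &
     forall y, W y -> f y = g y]) -> Ck k U f.
Proof.
elim: k f => //= k IHk f loc.
have nfg (x : R) (W : set R) g : open W -> W x -> (forall y, W y -> f y = g y) ->
    \near x, g x = f x.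
  move=> oW Wx fg; near=> y; apply/esym/fg; near: y; exact: open_nbhs_nbhs.
split=> [x /loc[W [g [oW Wx [dg _] fg]]]|].
  by apply: near_eq_derivable (dg _ Wx); exact: nfg fg.
apply: IHk => x /loc[W [g [oW Wx [_ Cg] fg]]].
exists W, ('D_1 g); split => // y Wy.
by apply/esym/near_eq_derive; exact: nfg fg.
Unshelve. all: by end_near. Qed.

Lemma Ck_cst k U (v : V) : Ck k U (cst v).
Proof.
elim: k v => //= k IHk v; split=> [x _|]; first exact: derivable_cst.
rewrite (_ : 'D_1 (cst v : R -> V) = cst 0) //.
by apply/funext => x; rewrite derive_cst.
Qed.

Lemma Ck_add k U f g : open U -> Ck k U f -> Ck k U g -> Ck k U (f + g).
Proof.
move=> oU; elim: k f g => //= k IHk f g [df Cf] [dg Cg].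
split=> [x Ux|]; first exact: derivableD (df x Ux) (dg x Ux).
apply: Ck_eq (IHk _ _ Cf Cg) => // x Ux.
by rewrite deriveD //; [exact: df|exact: dg].
Qed.

Lemma Ck_iterD k U f x : Ck k.+1 U f -> U x ->
  derivable (iter k (fun g : R -> V => 'D_1 g) f) x 1.
Proof.
elim: k f => [|k IHk] f; first by case=> df _; exact: df.
by move=> [_ Cf] Ux; rewrite iterSr; exact: IHk.
Qed.

End OneVariable.

Lemma Ck_scale (R : realType) (V : normedModType R) k (U : set R)
    (c : R -> R) (f : R -> V) : open U ->
  Ck k U (c : R -> R^o) -> Ck k U f -> Ck k U (fun x => c x *: f x).
Proof.
move=> oU; elim: k c f => //= k IHk c f Cc' Cf'.
have [[dc Cc] [df Cf]] := (Cc', Cf').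
have D x : U x -> is_derive x 1 (fun y => c y *: f y)
    (c x *: 'D_1 f x + 'D_1 c x *: f x).
  by move=> Ux; apply: is_derive_scale; apply: derivableP; [exact: dc|exact: df].
split=> [x /D[]//|].
apply: (@Ck_eq _ _ _ _ ((fun x => c x *: 'D_1 f x) + (fun x => 'D_1 c x *: f x))) => //.
  by move=> x /D[_ ->].
by apply: Ck_add => //; apply: IHk => //; exact: Ck_pred.
Qed.

Lemma Ck_comp (R : realType) (V : normedModType R) k (U W : set R)
    (th : R -> R) (f : R -> V) : open U -> (forall x, U x -> W (th x)) ->
  Ck k U (th : R -> R^o) -> Ck k W f -> Ck k U (f \o th).
Proof.
move=> oU UW; elim: k f => //= k IHk f Ct [df Cf]; have [dt Ct'] := Ct.
have D x : U x -> is_derive x 1 (f \o th) ('D_1 th x *: 'D_1 f (th x)).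
  move=> Ux; apply: is_derive_comp1; apply: derivableP; first exact: dt.
  exact/df/UW.
split=> [x /D[]//|].
apply: (@Ck_eq _ _ _ _ (fun x => 'D_1 th x *: ('D_1 f \o th) x)) => //.
  by move=> x /D[_ ->].
by apply: Ck_scale => //; apply: IHk => //; exact: Ck_pred.
Qed.

Lemma derive_multiple (R : realType) (V : normedModType R) (f : R -> V) (v x : R) :
  derivable f x 1 -> is_derive x v f (v *: 'D_1 f x).
Proof.
move=> df; have df' := (derivable1_diffP f x).1 df.
apply: DeriveDef; first exact: diff_derivable.
by rewrite !deriveE // -[X in 'd f x X]mulr1 [LHS]linearZ.
Qed.

(** On the line every direction is a multiple of [1], so an iterated directional derivative is the
    product of the directions times an iterated ['D_1]. Its differentiability gives the continuity
    that [smooth_on] asks for. *)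
Lemma smooth_on_Ck (R : realType) (V : normedModType R) (U : set R) (f : R -> V) :
  open U -> smooth_on U f <-> forall k, Ck k U f.
Proof.
move=> oU; split=> [sf k|Cf vs].
  have {sf} : forall j x, U x -> derivable (iter j (fun g : R -> V => 'D_1 g) f) x 1.
    move=> j x; have [_ /(_ x 1)] := sf (nseq j (1 : R)).
    suff -> : Defs.iterD (nseq j (1 : R)) f = iter j (fun g : R -> V => 'D_1 g) f by [].
    by elim: j => //= j ->.
  elim: k f => //= k IHk f df; split=> [x|]; first exact: (df 0%N).
  by apply: IHk => j x; rewrite -iterSr; exact: df.
have D : forall x, U x ->
    Defs.iterD vs f x = (\prod_(v <- vs) v) *: iter (size vs) (fun g : R -> V => 'D_1 g) f x.
  elim: vs => [|v vs IH] x Ux /=; first by rewrite big_nil scale1r.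
  have -> : 'D_v (Defs.iterD vs f) x = 'D_v ((\prod_(v <- vs) v) \*:
      iter (size vs) (fun g : R -> V => 'D_1 g) f) x.
    apply: near_eq_derive; near=> y; apply: IH; near: y; exact: open_nbhs_nbhs.
  have d1 : derivable (iter (size vs) (fun g : R -> V => 'D_1 g) f) x 1.
    by apply: Ck_iterD Ux; exact: Cf.
  have [d2 E] := derive_multiple v d1.
  by rewrite deriveZ // E big_cons scalerA mulrC.
have dv x v : U x -> derivable (Defs.iterD vs f) x v.
  move=> Ux.
  apply: (@near_eq_derivable _ _ _ ((\prod_(v <- vs) v) \*:
      iter (size vs) (fun g : R -> V => 'D_1 g) f)).
    near=> y; rewrite D //; near: y; exact: open_nbhs_nbhs.
  have d1 : derivable (iter (size vs) (fun g : R -> V => 'D_1 g) f) x 1.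
    by apply: Ck_iterD Ux; exact: Cf.
  have [d2 _] := derive_multiple v d1.
  by have := @derivableZ R _ V _ (\prod_(v <- vs) v) x v d2.
split=> // x Ux.
exact/differentiable_continuous/derivable1_diffP/(dv x 1).
Unshelve. all: by end_near. Qed.

(** * A flat smooth step function *)

Section SmoothStep.
Variable R : realType.
Implicit Types (P : {poly R}) (x : R).

(** The polynomial factor makes the family stable under differentiation: the derivative has the same
    form, with X^2 (P - P') in place of P. *)
Let flat P x : R := if 0 < x then P.[x^-1] * expR (1 - x^-1) else 0.

(** Each monomial is handled by exp y >= y^(i+1) / (i+1)!, which yields y^i exp (1 - y) <= e (i+1)!
    / y. *)
Let horner_expR_bound P : exists C : R, 0 <= C /\
  forall y, 0 < y -> `|P.[y] * expR (1 - y)| <= C / y.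
Proof.
exists (\sum_(i < size P) `|P`_i| * (expR 1 * (i.+1)`!%:R)); split.
  by apply: sumr_ge0 => i _; rewrite !mulr_ge0 // expR_ge0.
move=> y y0; rewrite horner_coef mulr_suml mulr_suml.
apply: le_trans (ler_norm_sum _ _ _) _; apply: ler_sum => i _.
rewrite -mulrA normrM -[leRHS]mulrA ler_wpM2l //.
rewrite ger0_norm; last by rewrite mulr_ge0 ?expR_ge0 // exprn_ge0 // ltW.
rewrite expRD mulrCA -mulrA ler_wpM2l ?expR_ge0 // expRN.
rewrite ler_pdivlMr // mulrAC -exprSr ler_pdivrMr ?expR_gt0 //.
rewrite mulrC -ler_pdivrMr ?ltr0n ?fact_gt0 //.
by apply: le_trans (expR_ge1Dxn i (ltW y0)); rewrite lerDr.
Qed.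

Let is_derive_flat P x : is_derive x 1 (flat P) (flat ('X^2 * (P - P^`())) x).
Proof.
have [x0|x0|->] := ltgtP x 0.
- rewrite [X in is_derive _ _ _ X](_ : _ = 0); last first.
    by rewrite /flat ltNge (ltW x0).
  have d0 : is_derive x (1 : R) (cst 0 : R -> R^o) 0 by exact: is_derive_cst.
  apply: near_eq_is_derive d0; near=> y; rewrite /flat ltNge ltW //; near: y; exact: lt_nbhsl.
- have xn0 : x != 0 by rewrite gt_eqF.
  have dV : is_derive x 1 (fun y : R => y^-1) (- x ^- 2).
    have := @is_deriveV R (@id R) x 1 1 xn0 (is_derive_id x 1).
    by move=> d; apply: is_derive_eq d _; rewrite /= [_ *: _]mulr1.
  have dP : is_derive x 1 (fun y : R => P.[y^-1]) (P^`().[x^-1] * - x ^- 2).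
    exact: (is_derive1_comp (is_derive_poly P x^-1) dV).
  have dE : is_derive x 1 (fun y : R => expR (1 - y^-1))
      (expR (1 - x^-1) * x ^- 2).
    have d1 : is_derive x (1 : R) (cst 1 : R -> R^o) 0 by exact: is_derive_cst.
    have dB : is_derive x 1 (fun y : R => 1 - y^-1) (x ^- 2).
      by apply: is_derive_eq (is_deriveB d1 dV) _; rewrite sub0r opprK.
    exact: (@is_derive1_comp R expR (fun y : R => 1 - y^-1) x _ _
      (is_derive_expR (1 - x^-1)) dB).
  have dM : is_derive x 1 (fun y : R => P.[y^-1] * expR (1 - y^-1))
      (flat ('X^2 * (P - P^`())) x).
    apply: is_derive_eq (is_deriveM dP dE) _.
    rewrite /flat x0 !hornerE /= /GRing.scale /= exprVn.
    ring.
  apply: near_eq_is_derive dM; near=> y.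
  rewrite /flat ifT //; near: y; exact: lt_nbhsr.
(* At [h^-1] the bound for ['X * P] gives |flat P h| <= C h^2: the extra factor X gains the power of
   [h] that sends the difference quotient at 0 to 0. *)
- have [C [C0 bC]] := horner_expR_bound ('X * P).
  have E0 Q : flat Q 0 = 0 by rewrite /flat ltxx.
  have bf h : `|flat P h| <= C * h ^+ 2.
    rewrite /flat; case: ifPn => [h0|_]; last by rewrite normr0 mulr_ge0 ?sqr_ge0.
    have := bC h^-1; rewrite invr_gt0 => /(_ h0).
    rewrite !hornerE invrK -mulrA normrM gtr0_norm ?invr_gt0 //.
    by rewrite mulrC ler_pdivrMr // expr2 mulrA.
  have L : h^-1 *: ((flat P \o shift 0) (h *: (1 : R)) - flat P 0)
      @[h --> 0^'] --> (0 : R).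
    apply/cvgrPdist_lt => e e0; near=> h.
    rewrite sub0r normrN /= E0 subr0 addr0 [_ *: 1]mulr1 normrZ.
    have h0 : h != 0 by near: h; exact: nbhs_dnbhs_neq.
    apply: (@le_lt_trans _ _ (C * `|h|)).
      rewrite normfV mulrC ler_pdivrMr ?normr_gt0 // -mulrA -expr2 real_normK //.
      exact: num_real.
    rewrite (@le_lt_trans _ _ ((C + 1) * `|h|)) //.
      by rewrite ler_wpM2r // lerDl.
    rewrite mulrC -ltr_pdivlMr ?ltr_wpDl //.
    near: h; apply: dnbhs0_lt; rewrite divr_gt0 // ltr_wpDl //.
  rewrite E0; apply: DeriveDef; first by apply/cvg_ex; exists 0.
  exact: cvg_lim L.
Unshelve. all: by end_near. Qed.

Let Ck_flat k P : Ck k setT (flat P : R -> R^o).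
Proof.
elim: k P => //= k IHk P; split=> [x _|]; first by have [] := is_derive_flat P x.
rewrite (_ : 'D_1 (flat P : R -> R^o) = flat ('X^2 * (P - P^`()))) //.
by apply/funext => x; have [_ ->] := is_derive_flat P x.
Qed.

(* The witness is [s x = 1 - rho (1 - rho x)] with [rho x = exp (1 - 1/x)] for [x > 0] and
   [rho x = 0] otherwise: [rho >= 1] on [[1, +oo[] and [rho 1 = 1]. *)
Lemma smooth_step : exists s : R -> R,
  [/\ forall k, Ck k setT (s : R -> R^o), forall x, x <= 0 -> s x = 0,
      forall x, 1 <= x -> s x = 1 & forall x, 0 <= s x <= 1].
Proof.
pose rho := flat 1.
have rho0 x : x <= 0 -> rho x = 0 by rewrite /rho /flat ltNge => ->.
have rhoE x : 0 < x -> rho x = expR (1 - x^-1).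
  by rewrite /rho /flat => ->; rewrite hornerE mul1r.
have rho_ge0 x : 0 <= rho x.
  by have [/rho0 -> //|/rhoE ->] := leP x 0; exact: expR_ge0.
have rho_le1 x : x <= 1 -> rho x <= 1.
  move=> x1; have [/rho0 -> //|x0] := leP x 0.
  by rewrite rhoE // expR_le1 subr_le0 invf_ge1.
have rho_ge1 x : 1 <= x -> 1 <= rho x.
  move=> x1; have x0 : 0 < x by exact: lt_le_trans x1.
  by rewrite rhoE // -[leLHS]expR0 ler_expR subr_ge0 invf_le1.
have rho1 : rho 1 = 1 by apply/eqP; rewrite eq_le rho_le1 // rho_ge1.
pose s x := 1 - rho (1 - rho x).
have CB (f : R -> R^o) k : Ck k setT f -> Ck k setT (fun x => 1 - f x : R^o).
  move=> Cf; apply: (@Ck_eq _ _ _ _ (cst (1 : R^o) + (fun x => (-1 : R) *: f x))) => //.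
  - exact: openT.
  - by move=> x _; exact: (congr1 (fun z => 1 + z) (scaleN1r (f x))).
  - apply: Ck_add; [exact: openT|exact: Ck_cst|].
    apply: (@Ck_scale R R^o k setT (cst (-1))) => //; first exact: openT.
    exact: Ck_cst.
exists s; split=> [k|x x0|x x1|x].
- apply: (CB); apply: (@Ck_comp R R^o k setT setT (fun x => 1 - rho x) rho) => //.
    exact: openT.
  by apply: CB; exact: Ck_flat.
  exact: Ck_flat.
- by rewrite /s (rho0 x x0) subr0 rho1 subrr.
- by rewrite /s (rho0 (1 - rho x)) ?subr0 // subr_le0 rho_ge1.
- rewrite /s lerBlDr lerDl rho_ge0 andbT subr_ge0 rho_le1 //.
  by rewrite lerBlDr lerDl rho_ge0.
Qed.

End SmoothStep.

(** * Gluing and smooth paths *)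

Lemma Ck_affine (R : realType) k (U : set R) (a b : R) :
  Ck k U (fun x => a * x + b : R^o).
Proof.
case: k => //= k.
have d (x : R) : is_derive x (1 : R) (fun x => a * x + b : R^o) a.
  have d1 : is_derive x (1 : R) (a \*: id : R -> R^o) (a *: (1 : R^o)).
    exact: is_deriveZ.
  have d2 : is_derive x (1 : R) (cst b : R -> R^o) 0 by exact: is_derive_cst.
  by apply: is_derive_eq (is_deriveD d1 d2) _; rewrite addr0 [_ *: _]mulr1.
split=> [x _|]; first by have [] := d x.
rewrite (_ : 'D_1 (fun x => a * x + b : R^o) = cst a); first exact: Ck_cst.
by apply/funext => x; have [_ ->] := d x.
Qed.

Lemma Ck_reparam (R : realType) (V : normedModType R) k (f : R -> V) (a b : R) :
  Ck k setT f -> Ck k setT (fun x => f (a * x + b)).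
Proof.
move=> Cf; apply: (@Ck_comp R V k setT setT (fun x => a * x + b) f) => //.
  exact: openT.
exact: Ck_affine.
Qed.

(** Agreement on a whole interval gives every point a neighbourhood on which [h] is [f] or is [g].
    The last clause keeps the values of [h] in any set containing those of [f] and [g]. *)
Lemma Ck_glue (R : realType) (V : normedModType R) (f g : R -> V) (a b : R) :
  a < b -> (forall k, Ck k setT f) -> (forall k, Ck k setT g) ->
  (forall x, a <= x <= b -> f x = g x) ->
  exists h : R -> V, [/\ forall k, Ck k setT h, forall x, x <= b -> h x = f x,
    forall x, a <= x -> h x = g x & forall x, h x = f x \/ h x = g x].
Proof.
move=> ab Cf Cg fg; pose h x := if x < b then f x else g x.
have hf x : x <= b -> h x = f x.
  rewrite /h le_eqVlt => /predU1P[->|->//]; rewrite ltxx; apply/esym/fg.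
  by rewrite lexx ltW.
have hg x : a <= x -> h x = g x.
  by rewrite /h => ax; case: ltP => // xb; rewrite fg // ax ltW.
exists h; split=> // [k|x]; last first.
  by rewrite /h; case: ifP => _; [left|right].
apply: Ck_local => x _; have [xb|bx] := ltP x b.
- exists [set y | y < b], f; split=> [|||y /ltW]; [|by []| |exact: hf].
    exact: open_lt.
  exact: (@Ck_subset _ _ _ setT).
- exists [set y | a < y], g; split=> [|||y /ltW]; last exact: hg.
  + exact: open_gt.
  + exact: lt_le_trans bx.
  + exact: (@Ck_subset _ _ _ setT).
Qed.

(* Along a line only iterated derivatives in the one direction [b] occur, so no
   chain rule in several variables is needed. *)
Lemma Ck_line (R : realType) (V W : normedModType R) (U : set V) (psi : V -> W)
    (y b : V) k : smooth_on U psi ->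
  Ck k [set s : R | U (y + s *: b)] (fun s => psi (y + s *: b)).
Proof.
move=> sm.
have {sm} : forall j x, U x -> derivable (iter j (fun g : V -> W => 'D_b g) psi) x b.
  move=> j x; have [_ /(_ x b)] := sm (nseq j b).
  suff -> : Defs.iterD (nseq j b) psi = iter j (fun g : V -> W => 'D_b g) psi by [].
  by elim: j => //= j ->.
have quotE (g : V -> W) (s : R) :
    (fun h : R => h^-1 *: (((fun s => g (y + s *: b)) \o shift s) (h *: (1 : R))
      - g (y + s *: b))) =
    (fun h : R => h^-1 *: ((g \o shift (y + s *: b)) (h *: b) - g (y + s *: b))).
  apply/funext => h /=; congr (_ *: (g _ - _)).
  by rewrite [_ *: 1]mulr1 scalerDl addrCA.
elim: k psi => //= k IHk psi sm; split=> [s Us|].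
  by rewrite /derivable quotE; exact: (sm 0%N).
rewrite (_ : 'D_1 (fun s : R => psi (y + s *: b)) = fun s => 'D_b psi (y + s *: b)).
  by apply: (IHk ('D_b psi)) => j x; rewrite -iterSr; exact: sm.
by apply/funext => s; rewrite /derive quotE.
Qed.

Section SmoothPaths.
Variables (R : realType) (V : normedModType R) (N : set V).

(** Being constant before 0 and after 1 makes all derivatives vanish at both ends, so such paths
    concatenate smoothly. *)
Definition smooth_path (p q : V) := exists gam : R -> V,
  [/\ forall k, Ck k setT gam, forall t, N (gam t),
      forall t, t <= 0 -> gam t = p & forall t, 1 <= t -> gam t = q].

(** The first path is run during [0, 1/3] and the second during [2/3, 1]; in between both rest at
    [q], which is the overlap needed for gluing. *)
Lemma smooth_path_trans p q r : smooth_path p q -> smooth_path q r ->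
  smooth_path p r.
Proof.
move=> [f [Cf Nf fp fq]] [g [Cg Ng gq gr]].
have [|k|k|x /andP[x1 x2]|h [Ch hf hg hfg]] := @Ck_glue _ _ (fun x => f (3 * x + 0))
  (fun x => g (3 * x + -2)) 3^-1 (2 / 3).
- lra.
- exact: Ck_reparam.
- exact: Ck_reparam.
- by rewrite fq ?gq //; lra.
exists h; split=> // t.
- by have [->|->] := hfg t.
- by move=> t0; rewrite hf ?fp //; lra.
- by move=> t1; rewrite hg ?gr //; lra.
Qed.

(** The set [B] of points reachable from [p] is open and closed in [N]. Local paths leaving [q]
    serve openness, those returning to [q] serve closedness, and no path has to be reversed. *)
Lemma connected_smooth_path (p : V) : connected N -> N p ->
  (forall q, N q -> \forall r \near q, N r -> smooth_path q r /\ smooth_path r q) ->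
  smooth_path p p -> forall q, N q -> smooth_path p q.
Proof.
move=> cN Np loc pp q Nq.
pose B := [set q | N q /\ smooth_path p q].
suff BN : B = N by have [] : B q by rewrite BN.
apply: cN; first by exists p.
- exists (interior [set r | N r -> smooth_path p r]); first exact: open_interior.
  apply/seteqP; split=> r [Nr pr]; split=> //; last exact: nbhs_singleton pr Nr.
  apply: filterS (loc _ Nr) => s rs Ns.
  by apply: smooth_path_trans pr _; have [] := rs Ns.
- exists (closure B); first exact: closed_closure.
  apply/seteqP; split=> r [Nr pr]; split=> //; first exact: subset_closure.
  have [s [[Ns ps] /(_ Ns)[_ sr]]] := pr _ (loc _ Nr).
  exact: smooth_path_trans sr.
Qed.

End SmoothPaths.

(** In a chart [N] is a linear slice, so the segment between two points of the slice in a ball stays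
    in both; [psi] carries it to [N], and the step [s] makes it constant outside [0, 1]. *)
Lemma submanifold_near_path (R : realType) n k (N : set (cmx R n)) q :
  smooth_submanifold k N -> N q ->
  \forall r \near q, N r -> smooth_path N q r /\ smooth_path N r q.
Proof.
move=> sub Nq; have [U [W [phi [psi [[oU Uq oW sphi spsi] [phiK psiK NE]]]]]] := sub _ Nq.
have /nbhs_ballP[e /= e0 eW] : nbhs (phi q) W.
  by apply: open_nbhs_nbhs; split=> //; have [] := phiK _ Uq.
have [s [Cs s0 s1 s01]] := smooth_step R.
have path r t : U r -> U t -> N r -> N t -> ball (phi q) e (phi r) ->
    ball (phi q) e (phi t) -> smooth_path N r t.
  move=> Ur Ut Nr Nt br bt.
  pose seg x := phi r + x *: (phi t - phi r).
  have Wseg x : 0 <= x <= 1 -> W (seg x).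
    move=> /andP[x0 x1]; apply: eW; move: br bt.
    rewrite -!ball_normE /= => br bt.
    have -> : phi q - seg x = (1 - x) *: (phi q - phi r) + x *: (phi q - phi t).
      have tr : phi t - phi r = (phi q - phi r) - (phi q - phi t).
        by rewrite opprB [RHS]addrC addrA subrK.
      rewrite /seg opprD addrA tr; move: (phi q - phi r) (phi q - phi t) => u v.
      by rewrite scalerBr scalerBl scale1r opprB addrA addrAC.
    apply: le_lt_trans (ler_normD _ _) _; rewrite !normrZ.
    rewrite (ger0_norm x0) ger0_norm ?subr_ge0 //.
    (* For [x > 0] the strict inequality comes from the second summand; [x = 0] is treated apart. *)
    move: (x0) br bt; rewrite le_eqVlt => /predU1P[<-|xp] br bt.
      by rewrite subr0 mul1r mul0r addr0.
    have h1 : 0 < x * (e - `|phi q - phi t|) by rewrite mulr_gt0 // subr_gt0.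
    have h2 : 0 <= (1 - x) * (e - `|phi q - phi r|).
      by rewrite mulr_ge0 // subr_ge0 // ltW.
    lra.
  exists (fun x => psi (seg (s x))); split.
  - move=> j; apply: (@Ck_comp R _ j setT [set x | W (seg x)] s (fun x => psi (seg x))).
    + exact: openT.
    + by move=> x _; exact: Wseg.
    + exact: Cs.
    + exact: Ck_line.
  - move=> x; have [Ux Ex] := psiK _ (Wseg _ (s01 x)).
    apply/NE => //; rewrite Ex => i ki; rewrite /seg !mxE.
    have /NE/(_ i ki) -> := Nr => //.
    have /NE/(_ i ki) -> := Nt => //.
    by rewrite subr0 mulr0 addr0.
  - by move=> x /s0; rewrite /seg => ->; rewrite scale0r addr0; have [] := phiK _ Ur.
  - by move=> x /s1; rewrite /seg => ->; rewrite scale1r addrCA subrr addr0; have [] := phiK _ Ut.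
have cphi : {for q, continuous phi} by have [/(_ q Uq)] := sphi [::].
have bq : ball (phi q) e (phi q) by exact: ballxx.
near=> r => Nr.
have Ur : U r by near: r; exact: open_nbhs_nbhs.
have br : ball (phi q) e (phi r).
  by near: r; apply: cphi; exact: nbhsx_ballx.
by split; apply: path.
Unshelve. all: by end_near. Qed.

(** * Leading a smooth function to a base point at both ends *)

Section CutOff.
Variables (R : realType) (V : normedModType R) (N : set V) (p0 : V).
Hypothesis path0 : forall q, N q -> smooth_path N p0 q.

(** The function [g \o th] rests at [g c] up to the midpoint [c] and is [g] again from [b] on, so a
    path from [p0] to [g c] can be glued in front of it. *)
Lemma smooth_start (g : R -> V) (a b : R) : a < b ->
  (forall k, Ck k setT g) -> (forall x, N (g x)) ->
  exists h : R -> V, [/\ forall k, Ck k setT h, forall x, N (h x),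
    forall x, x <= a -> h x = p0 & forall x, b <= x -> h x = g x].
Proof.
move=> ab Cg Ng; have [s [Cs s0 s1 _]] := smooth_step R.
(* With slope [l] the path from [p0] is completed between [a] and [(a + c) / 2], which leaves an
   overlap up to [c]; and [s] has reached 1 at [b], since [l * (b - c) = 2]. *)
pose c := (a + b) / 2; pose l := 4 / (b - a).
have l0 : 0 < l by rewrite divr_gt0 // subr_gt0.
have lE : l * (b - a) = 4 by rewrite divfK // subr_eq0 gt_eqF.
pose th x : R := (1 * x - c) *: (s (l * x - l * c) : R^o) + c.
have Cth k : Ck k setT (th : R -> R^o).
  apply: Ck_add; [exact: openT| |exact: Ck_cst].
  apply: (@Ck_scale R R^o k setT (fun x => 1 * x - c)); first exact: openT.
    exact: Ck_affine.
  exact: (@Ck_reparam R R^o k s).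
have thc x : x <= c -> th x = c.
  move=> xc; rewrite /th s0 ?scaler0 ?add0r //.
  by rewrite -mulrBr pmulr_rle0 // subr_le0.
have thb x : b <= x -> th x = x.
  move=> bx; rewrite /th s1 /c.
    by rewrite [_ *: _]mulr1; lra.
  by rewrite -mulrBr /c; nra.
have [gam [Cgam Ngam gam0 gam1]] := path0 (Ng c).
have [|k|k|x /andP[x1 x2]|h [Ch hf hg hfg]] := @Ck_glue _ _
  (fun x => gam (l * x + - (l * a))) (g \o th) ((a + c) / 2) c.
- by rewrite /c; lra.
- exact: Ck_reparam.
- by apply: (@Ck_comp R V k setT setT th g) => //; exact: openT.
- rewrite /= thc // gam1 //; move: x1; rewrite /c => x1.
  have : l * ((b - a) / 4) <= l * (x - a) by rewrite (ler_wpM2l (ltW l0)) //; lra.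
  by rewrite mulrA lE divff ?pnatr_eq0 // mulrBr.
exists h; split=> // [x|x xa|x bx].
- by have [->|->] := hfg x; [exact: Ngam|exact: Ng].
- rewrite hf ?gam0 /c; [by []| |lra].
  by rewrite -mulrBr pmulr_rle0 // subr_le0.
- by rewrite hg /= ?thb // /c; lra.
Qed.

(** The right end is obtained from [smooth_start] applied to the reflected function, between [- d]
    and [- c]. *)
Lemma smooth_cutoff (g : R -> V) (a b c d : R) : a < b -> b <= c -> c < d ->
  (forall k, Ck k setT g) -> (forall x, N (g x)) ->
  exists h : R -> V, [/\ forall k, Ck k setT h, forall x, N (h x),
    forall x, x <= a -> h x = p0, forall x, b <= x <= c -> h x = g x &
    forall x, d <= x -> h x = p0].
Proof.
move=> ab bc cd Cg Ng.
have [h [Ch Nh h0 hE]] := smooth_start ab Cg Ng.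
have ndc : - d < - c by rewrite ltrN2.
have [||h' [Ch' Nh' h'0 h'E]] := @smooth_start (fun x => h (- 1 * x + 0)) _ _ ndc.
- by move=> k; exact: Ck_reparam.
- by [].
have E x : x <= c -> h' (- 1 * x + 0) = h x.
  by move=> xc; rewrite h'E; [congr (h _); lra|lra].
exists (fun x => h' (- 1 * x + 0)); split=> [k|//|x xa|x /andP[bx xc]|x dx].
- exact: Ck_reparam.
- by rewrite E ?h0 //; lra.
- by rewrite E ?hE.
- by rewrite h'0 //; lra.
Qed.

End CutOff.

(** * Fractional part and periodic extension *)

Definition frac (R : realType) (x : R) : R := x - (Num.floor x)%:~R.

Lemma frac_ge0_lt1 (R : realType) (x : R) : 0 <= frac x < 1.
Proof.
have /andP[fx xf] := floor_itv x.
by rewrite /frac subr_ge0 fx ltrBlDl -intrD1.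
Qed.

Lemma frac_eq (R : realType) (x : R) (m : int) :
  m%:~R <= x < m%:~R + 1 -> frac x = x - m%:~R.
Proof. by rewrite -intrD1 /frac => mx; rewrite (floor_def mx). Qed.

Lemma fracD1 (R : realType) (x : R) : frac (x + 1) = frac x.
Proof.
have /andP[fx xf] := floor_itv x.
rewrite (@frac_eq _ _ (Num.floor x + 1)); first by rewrite /frac intrD1; lra.
by move: fx xf; rewrite !intrD1 => fx xf; lra.
Qed.

(** The common constant value [p] at both ends of the period makes the translated copies of [h]
    match smoothly across the integers. *)
Lemma Ck_periodize (R : realType) (V : normedModType R) (h : R -> V) (p : V)
    (a b : R) k : 0 < a -> 0 <= b -> b < 1 -> Ck k setT h ->
  (forall x, x <= a -> h x = p) -> (forall x, b <= x -> h x = p) ->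
  Ck k setT (h \o @frac R).
Proof.
move=> a0 b0 b1 Ch ha hb; apply: Ck_local => x _.
pose m := Num.floor x; have /andP[mx xm] := floor_itv x.
rewrite intrD1 -/m in mx xm.
(* For [y] in this interval left of [m], [frac y > b] and [y - m < 0 < a], so both sides equal
   [p]. *)
exists [set` `](m%:~R - (1 - b)), (m%:~R + 1)[], (fun y => h (1 * y - m%:~R)).
split=> [||| y /=].
- exact: interval_open.
- by rewrite /= in_itv /=; lra.
- by apply: (@Ck_subset _ _ _ setT) => //; exact: Ck_reparam.
rewrite in_itv /= => /andP[y1 y2]; have [my|ym] := leP m%:~R y.
  by rewrite mul1r (@frac_eq _ _ m) // my.
rewrite (@frac_eq _ _ (m - 1)) intrB; last lra.
by rewrite [RHS]ha ?[LHS]hb //; lra.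
Qed.

(** * Square-integrable loops *)

Section HilbertSchmidt.
Variables (R : realType) (n : nat).
Implicit Types (A B : cmx R n) (u v : R -> cmx R n).

Lemma hs2_ge0 A : 0 <= hs2 A.
Proof.
by apply: sumr_ge0 => i _; apply: sumr_ge0 => j _; rewrite addr_ge0 ?sqr_ge0.
Qed.

Lemma hs20 : hs2 (0 : cmx R n) = 0.
Proof. by rewrite /hs2 big1 // => i _; rewrite big1 // => j _; rewrite !mxE expr0n addr0. Qed.

Lemma hs2N A : hs2 (- A) = hs2 A.
Proof.
rewrite /hs2; apply: eq_bigr => i _; apply: eq_bigr => j _.
by rewrite !mxE !sqrrN.
Qed.

(** Entrywise (x + y)^2 <= 2 x^2 + 2 y^2. This replaces the triangle inequality, so that all
    estimates are made on squared norms. *)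
Lemma hs2D A B : hs2 (A + B) <= 2 * hs2 A + 2 * hs2 B.
Proof.
rewrite /hs2 !mulr_sumr -big_split /=; apply: ler_sum => i _.
rewrite !mulr_sumr -big_split /=; apply: ler_sum => j _.
rewrite !mxE; have := sqr_ge0 (A.1 i j - B.1 i j).
by have := sqr_ge0 (A.2 i j - B.2 i j); lra.
Qed.

Lemma hs2B A B : hs2 (A - B) <= 2 * hs2 A + 2 * hs2 B.
Proof. by rewrite -(hs2N B); exact: hs2D. Qed.

Lemma continuous_entries i j :
  continuous (fun A : cmx R n => A.1 i j) /\ continuous (fun A : cmx R n => A.2 i j).
Proof.
split=> A.
  apply: (@continuous_comp _ _ _ fst (fun M : 'M[R]_n => M i j) A); first exact: cvg_fst.
  exact: coord_continuous.
apply: (@continuous_comp _ _ _ snd (fun M : 'M[R]_n => M i j) A); first exact: cvg_snd.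
exact: coord_continuous.
Qed.

Lemma continuous_hs2 : continuous (fun A : cmx R n => hs2 A).
Proof.
rewrite /hs2.
apply: continuous_big => [|i _]; first exact: add_continuous.
apply: continuous_big => [|j _ A]; first exact: add_continuous.
have [c1 c2] := continuous_entries i j.
have sq (f : cmx R n -> R) : continuous f -> {for A, continuous (fun B => f B ^+ 2)}.
  move=> cf; apply: (@continuous_comp _ _ _ f (fun x : R => x ^+ 2) A); first exact: cf.
  exact: exprn_continuous.
by apply: cvgD; apply: (sq).
Qed.

Lemma compact_hs2_bound (N : set (cmx R n)) : compact N ->
  exists2 M : R, 0 <= M & forall A, N A -> hs2 A <= M.
Proof.
move=> cN; have [->|/set0P N0] := eqVneq N set0; first by exists 0.
have [|A _ AM] := compact_EVT_max N0 cN (f := @hs2 R n : cmx R n -> R).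
  exact/continuous_subspaceT/continuous_hs2.
by exists (hs2 A); [exact: hs2_ge0|move=> B /mem_set; exact: AM].
Qed.

Definition measurable_entries u := forall i j,
  measurable_fun setT (fun t => (u t).1 i j) /\
  measurable_fun setT (fun t => (u t).2 i j).

Lemma measurable_entriesB u v : measurable_entries u -> measurable_entries v ->
  measurable_entries (fun t => u t - v t).
Proof.
move=> mu mv i j; have [mu1 mu2] := mu i j; have [mv1 mv2] := mv i j.
split.
- rewrite (_ : (fun t => _) = fun t => (u t).1 i j - (v t).1 i j).
    exact: measurable_funB.
  by apply/funext => t; rewrite !mxE.
- rewrite (_ : (fun t => _) = fun t => (u t).2 i j - (v t).2 i j).
    exact: measurable_funB.
  by apply/funext => t; rewrite !mxE.
Qed.

Lemma measurable_hs2 u : measurable_entries u ->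
  measurable_fun setT (fun t => hs2 (u t)).
Proof.
move=> mu; apply: measurable_sum => i; apply: measurable_sum => j.
have [mu1 mu2] := mu i j.
by apply: measurable_funD; apply: measurable_funX.
Qed.

Definition hs2_int u : \bar R :=
  (\int[lebesgue_measure]_(t in `[0%R, 1%R]) (hs2 (u t))%:E)%E.

Lemma hs2_int_ge0 u : (0 <= hs2_int u)%E.
Proof. by apply: integral_ge0 => t _; rewrite lee_fin hs2_ge0. Qed.

(** Common form of the L2 estimates: approximation errors enter through [a] and [b], and a bounded
    error on a set of controlled measure through [C] and [S]. *)
Lemma hs2_int_bound u a b (K K' C l : R) (S : set R) :
  measurable_entries u -> measurable_entries a -> measurable_entries b ->
  measurable S -> (lebesgue_measure S <= l%:E)%E ->
  0 <= K -> 0 <= K' -> 0 <= C ->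
  (forall t, 0 <= t < 1 ->
     hs2 (u t) <= K * hs2 (a t) + K' * hs2 (b t) + C * \1_S t) ->
  (hs2_int u <= K%:E * hs2_int a + K'%:E * hs2_int b + (C * l)%:E)%E.
Proof.
move=> mu ma mb mS Sl K0 K'0 C0 le.
have mE (f : R -> R) (D : set R) : measurable_fun setT f -> measurable_fun D (EFin \o f).
  by move=> mf; apply/measurable_EFinP; exact: measurable_funTS.
(* The pointwise bound is given on the half-open interval, where [frac t = t]; the endpoint 1 has
   measure zero. *)
have half (f : R -> R) : measurable_fun setT f ->
   (\int[lebesgue_measure]_(t in `[0%R, 1%R]) (f t)%:E =
    \int[lebesgue_measure]_(t in `[0%R, 1%R[) (f t)%:E)%E.
  by move=> mf; rewrite integral_itv_bndo_bndc //; exact: mE.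
rewrite /hs2_int !half; [|exact: measurable_hs2..].
have mI : measurable (`[0%R, 1%R[ : set R) by [].
have m1 : measurable_fun setT (\1_S : R -> R) by exact: measurable_indic.
have ge (f : R -> R) t : 0 <= f t -> (0 <= (f t)%:E)%E by rewrite lee_fin.
have Z (f : R -> R) c : measurable_fun setT f -> (forall t, 0 <= f t) -> 0 <= c ->
   (c%:E * \int[lebesgue_measure]_(t in `[0%R, 1%R[) (f t)%:E =
    \int[lebesgue_measure]_(t in `[0%R, 1%R[) (c * f t)%:E)%E.
  move=> mf f0 c0; rewrite -ge0_integralZl_EFin //.
  - by move=> t _; rewrite lee_fin.
  - exact: mE.
have D (f g : R -> R) : measurable_fun setT f -> (forall t, 0 <= f t) ->
    measurable_fun setT g -> (forall t, 0 <= g t) ->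
   (\int[lebesgue_measure]_(t in `[0%R, 1%R[) (f t)%:E +
    \int[lebesgue_measure]_(t in `[0%R, 1%R[) (g t)%:E =
    \int[lebesgue_measure]_(t in `[0%R, 1%R[) (f t + g t)%:E)%E.
  move=> mf f0 mg g0; rewrite -ge0_integralD //.
  - by move=> t _; rewrite lee_fin.
  - exact: mE.
  - by move=> t _; rewrite lee_fin.
  - exact: mE.
have SI : ((C%:E * \int[lebesgue_measure]_(t in `[0%R, 1%R[) (\1_S t)%:E) <= (C * l)%:E)%E.
  rewrite integral_indic // EFinM lee_wpmul2l ?lee_fin //.
  apply: le_trans Sl; apply: le_measure; rewrite ?inE //.
  exact: measurableI.
apply: le_trans (leeD (lexx _) SI).
have mha := measurable_hs2 ma; have mhb := measurable_hs2 mb.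
have mka : measurable_fun setT (fun t => K * hs2 (a t)) by exact: measurable_funM.
have mkb : measurable_fun setT (fun t => K' * hs2 (b t)) by exact: measurable_funM.
have mk1 : measurable_fun setT (fun t => C * \1_S t : R) by exact: measurable_funM.
have ka t : 0 <= K * hs2 (a t) by rewrite mulr_ge0 ?hs2_ge0.
have kb t : 0 <= K' * hs2 (b t) by rewrite mulr_ge0 ?hs2_ge0.
have k1 t : 0 <= C * \1_S t by rewrite mulr_ge0.
rewrite !Z //; [|by move=> t; exact: hs2_ge0..].
rewrite D // D //; [|exact: measurable_funD|by move=> t; rewrite addr_ge0].
apply: ge0_le_integral => //.
- by move=> t _; rewrite lee_fin hs2_ge0.
- by apply: (mE); exact: measurable_hs2.
- by apply: (mE); apply: measurable_funD => //; exact: measurable_funD.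
Qed.

End HilbertSchmidt.

Section SquareIntegrable.
Variables (R : realType) (n : nat).
Implicit Types (u v a b f g : R -> cmx R n).

(** Finiteness is concluded as well, because [fine] sends infinity to 0 and a bound on it alone
    would say nothing. *)
Lemma fine_hs2_int_bound u a b (K K' C l : R) (S : set R) :
  measurable_entries u -> measurable_entries a -> measurable_entries b ->
  (hs2_int a < +oo)%E -> (hs2_int b < +oo)%E ->
  measurable S -> (lebesgue_measure S <= l%:E)%E ->
  0 <= K -> 0 <= K' -> 0 <= C ->
  (forall t, 0 <= t < 1 ->
     hs2 (u t) <= K * hs2 (a t) + K' * hs2 (b t) + C * \1_S t) ->
  (hs2_int u < +oo)%E /\
  fine (hs2_int u) <= K * fine (hs2_int a) + K' * fine (hs2_int b) + C * l.
Proof.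
move=> mu ma mb fa fb mS Sl K0 K'0 C0 le.
have fE (v : R -> cmx R n) : (hs2_int v < +oo)%E -> hs2_int v = (fine (hs2_int v))%:E.
  by move=> fv; rewrite fineK // ge0_fin_numE ?hs2_int_ge0.
have := hs2_int_bound mu ma mb mS Sl K0 K'0 C0 le.
have := hs2_int_ge0 u.
rewrite (fE a fa) (fE b fb) -!EFinM -!EFinD /=.
case: (hs2_int u) => [r|//|//] _ /=.
by rewrite lee_fin => ?; split=> //; exact: ltry.
Qed.

Lemma L2_measurable f : L2 f -> measurable_entries f.
Proof. by case. Qed.

Lemma L2_sub_lty f g : L2 f -> L2 g -> (hs2_int (fun t => (f t - g t)%R) < +oo)%E.
Proof.
move=> [_ mf fi] [_ mg gi].
have S0 : (lebesgue_measure (set0 : set R) <= 0%:E)%E by rewrite measure0.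
have [|//] := @fine_hs2_int_bound (fun t => f t - g t) f g 2 2 0 0 set0
  (measurable_entriesB mf mg) mf mg fi gi measurable0 S0 (ler0n _ 2) (ler0n _ 2) (lexx _).
by move=> t _; rewrite mul0r addr0 hs2B.
Qed.

Lemma L2dist_lt f g (e : R) : 0 < e ->
  (L2dist f g < e) = (fine (hs2_int (fun t => f t - g t)) < e ^+ 2).
Proof.
move=> e0; rewrite /L2dist -[e in LHS](ger0_norm (ltW e0)) -sqrtr_sqr.
by rewrite ltr_sqrt // exprn_gt0.
Qed.

Lemma smooth_loop_L2 (N : set (cmx R n)) g : compact N -> smooth_loop N g -> L2 g.
Proof.
move=> cN [pg sg Ng]; have [M M0 NM] := compact_hs2_bound cN.
have cg : continuous g by move=> x; have [/(_ x I)] := sg [::].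
have mg : measurable_entries g.
  move=> i j; have [c1 c2] := @continuous_entries R n i j.
  split; apply: continuous_measurable_fun => x.
    by apply: (@continuous_comp _ _ _ g (fun A : cmx R n => A.1 i j) x); [exact: cg|exact: c1].
  by apply: (@continuous_comp _ _ _ g (fun A : cmx R n => A.2 i j) x); [exact: cg|exact: c2].
split=> //.
have mI : measurable (`[0%R, 1%R]%classic : set R) by exact: measurable_itv.
have lI : (lebesgue_measure (`[0%R, 1%R]%classic : set R) <= 1%:E)%E.
  by rewrite lebesgue_measure_itv /= lte_fin ltr01 oppr0 adde0.
have z0 : measurable_entries (fun _ : R => 0 : cmx R n) by move=> i j; split; exact: measurable_cst.
have fz : (hs2_int (fun _ : R => 0%R : cmx R n) < +oo)%E.
  by rewrite /hs2_int integral0_eq // => x _; rewrite hs20.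
have [|//] := @fine_hs2_int_bound g (fun=> 0) (fun=> 0) 0 0 M 1 _ mg z0 z0 fz fz
  mI lI (lexx _) (lexx _) M0.
move=> t /andP[t0 t1]; rewrite !mul0r !add0r indicE mem_set ?mulr1 ?NM //.
by rewrite /= in_itv /= t0 ltW.
Qed.

(** Testing [frac x] instead of [x] keeps the cut loop periodic. *)
Definition cut (t : R) f : R -> cmx R n := fun x => if frac x < t then 0 else f x.

Lemma measurable_frac : measurable_fun setT (@frac R).
Proof.
apply: measurable_funB; first exact: measurable_id.
apply: nondecreasing_measurable => // x y xy.
by rewrite ler_int; exact: le_floor.
Qed.

Lemma L2_cut t f : L2 f -> L2 (cut t f).
Proof.
move=> [pf mf fi].
have mc : measurable_entries (cut t f).
  have mlt : measurable_fun setT (fun x => frac x < t).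
    by apply: measurable_fun_ltr; [exact: measurable_frac|exact: measurable_cst].
  move=> i j; have [m1 m2] := mf i j; split.
    rewrite (_ : (fun x => _) = fun x => if frac x < t then 0 else (f x).1 i j).
      by apply: measurable_fun_ifT => //; exact: measurable_cst.
    by apply/funext => x; rewrite /cut; case: ifP => // _; rewrite mxE.
  rewrite (_ : (fun x => _) = fun x => if frac x < t then 0 else (f x).2 i j).
    by apply: measurable_fun_ifT => //; exact: measurable_cst.
  by apply/funext => x; rewrite /cut; case: ifP => // _; rewrite mxE.
split=> // [x|]; first by rewrite /cut fracD1 pf.
have S0 : (lebesgue_measure (set0 : set R) <= 0%:E)%E by rewrite measure0.
have [|//] := @fine_hs2_int_bound (cut t f) f f 1 0 0 0 set0 mc mf mf fi fi
  measurable0 S0 ler01 (lexx _) (lexx _).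
move=> x _; rewrite mul1r !mul0r !addr0 /cut.
by case: ifP => // _; rewrite hs20 hs2_ge0.
Qed.

End SquareIntegrable.

(** * The contraction *)

Section Cutting.
Variables (R : realType) (n : nat) (N : set (cmx R n)).
Hypotheses (cN : compact N) (N0 : N 0).
Hypothesis path0 : forall q, N q -> smooth_path N 0 q.

Lemma smooth_loop_cst p : N p -> smooth_loop N (fun=> p).
Proof.
move=> Np; split=> //; apply/smooth_on_Ck; first exact: openT.
by move=> k; exact: Ck_cst.
Qed.

Lemma L2N_loop g : smooth_loop N g -> L2N N g.
Proof.
move=> sg; split=> [|e e0]; first exact: smooth_loop_L2 cN sg.
exists g; split=> //; rewrite L2dist_lt //.
rewrite [X in fine X](_ : _ = 0%E) ?exprn_gt0 //.
by rewrite /hs2_int integral0_eq // => x _; rewrite subrr hs20.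
Qed.

Lemma cut0 f : cut 0 f = f :> (R -> cmx R n).
Proof.
apply/funext => x; rewrite /cut ltNge.
by have /andP[->] := frac_ge0_lt1 x.
Qed.

Lemma cut1 f : cut 1 f = (fun=> 0) :> (R -> cmx R n).
Proof.
by apply/funext => x; rewrite /cut; have /andP[_ ->] := frac_ge0_lt1 x.
Qed.

Lemma frac_id (x : R) : 0 <= x < 1 -> frac x = x.
Proof. by move=> x01; rewrite (@frac_eq _ _ 0) ?subr0 ?add0r. Qed.

(** The loop [h] leaves 0 at [t], follows [g] from [t + d] to [1 - 2 * d] and is back at 0 from
    [1 - d] on; resting at 0 at both ends of the period makes it periodizable. *)
Lemma cut_smooth_loop (g : R -> cmx R n) (t d : R) : smooth_loop N g ->
  0 < t -> 0 < d -> t + 4 * d <= 1 ->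
  exists2 h, smooth_loop N h & forall x, 0 <= x < 1 ->
    ~ (`[t, t + d] `|` `[1 - 2 * d, 1])%classic x -> cut t g x = h x.
Proof.
move=> [pg sg Ng] t0 d0 td.
have Cg : forall k, Ck k setT g by apply/smooth_on_Ck; first exact: openT.
have [|||h [Ch Nh h0 hE h1]] := @smooth_cutoff R _ N 0 path0 g t (t + d)
  (1 - 2 * d) (1 - d) _ _ _ Cg Ng; [lra..|].
exists (h \o @frac R).
  split=> [x|| x]; [by rewrite /= fracD1| |exact: Nh].
  apply/smooth_on_Ck; first exact: openT.
  by move=> k; apply: (@Ck_periodize _ _ h 0 t (1 - d)) => //; lra.
move=> x x01 nS; rewrite /cut /= frac_id //.
have [xt|tx] := ltP x t; first by rewrite h0 // ltW.
rewrite hE //; move: x01 => /andP[x0 x1].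
rewrite !leNgt; apply/andP; split; apply/negP => hx; apply: nS.
  by left; rewrite /= in_itv /= tx ltW.
by right; rewrite /= in_itv /= !ltW.
Qed.

(** A smoothed cut of a loop [g] near [f] approximates [cut t f]. Smoothing needs room on both sides
    of [t], so the times 0 and 1 are treated apart. *)
Lemma L2N_cut t f : 0 <= t <= 1 -> L2N N f -> L2N N (cut t f).
Proof.
move=> /andP[t0 t1] Xf; have [Lf af] := Xf.
have [->|tn0] := eqVneq t 0; first by rewrite cut0.
have [->|tn1] := eqVneq t 1.
  by rewrite cut1; apply: L2N_loop; exact: smooth_loop_cst.
have {tn0}t0 : 0 < t by rewrite lt_def tn0.
have {tn1}t1 : t < 1 by rewrite lt_def eq_sym tn1.
split=> [|e e0]; first exact: L2_cut.
have [M M0 NM] := compact_hs2_bound cN.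
have [g [sg fg]] := af (e / 2) ltac:(lra).
(* The first bound makes room for [4 * d] after [t]. By the second, the squared error is below 2
   (e/2)^2 + 8 M (3 d) <= e^2/2 + e^2/4; [M + 1] avoids a division by 0. *)
pose d := Num.min ((1 - t) / 4) (e ^+ 2 / (96 * (M + 1))).
have e20 : 0 < e ^+ 2 by rewrite exprn_gt0.
have M1 : 0 < 96 * (M + 1) by lra.
have d0 : 0 < d by rewrite lt_min !divr_gt0 //; lra.
have d1 : t + 4 * d <= 1.
  have : d <= (1 - t) / 4 by rewrite ge_min lexx.
  lra.
have d2 : 96 * (M + 1) * d <= e ^+ 2.
  by rewrite mulrC -ler_pdivlMr // ge_min lexx orbT.
have [h sh hE] := cut_smooth_loop sg t0 d0 d1.
exists h; split=> //.
have [Lg Lh] := (smooth_loop_L2 cN sg, smooth_loop_L2 cN sh).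
have Lc := L2_cut t Lf.
rewrite L2dist_lt //; move: fg; rewrite L2dist_lt; last lra.
set S := (`[t, t + d] `|` `[1 - 2 * d, 1])%classic in hE.
have mS : measurable (S : set R) by apply: measurableU.
have lS : (lebesgue_measure (S : set R) <= (3 * d)%:E)%E.
  have l1 : lebesgue_measure (`[t, t + d]%classic : set R) = d%:E.
    by rewrite lebesgue_measure_itv /= lte_fin ltrDl d0 -EFinB addrC addKr.
  have l2 : lebesgue_measure (`[1 - 2 * d, 1]%classic : set R) = (2 * d)%:E.
    rewrite lebesgue_measure_itv /= lte_fin ifT; last lra.
    by rewrite -EFinB subKr.
  have -> : (3 * d)%:E = (d%:E + (2 * d)%:E)%E by rewrite -EFinD; congr EFin; lra.
  by rewrite -l1 -l2; apply: measureU2; exact: measurable_itv.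
have mfg := measurable_entriesB (L2_measurable Lf) (L2_measurable Lg).
have ffg := L2_sub_lty Lf Lg.
have M8 : 0 <= 8 * M by rewrite mulr_ge0.
have [|_] := @fine_hs2_int_bound _ _ (fun x => cut t f x - h x) _ _ 2 0 (8 * M)
  (3 * d) S (measurable_entriesB (L2_measurable Lc) (L2_measurable Lh))
  mfg mfg ffg ffg mS lS (ler0n _ 2) (lexx _) M8; last first.
  rewrite mul0r addr0 expr_div_n; nra.
move=> x x01; rewrite mul0r addr0.
(* Off [S], [h] is [cut t g], which leaves 0 or [f - g]. On [S], [g] and [h] both lie in [N], so
   their difference has squared norm at most 4 M, doubled by [hs2D]. *)
have [/mem_set xS|xS] := pselect (S x); last first.
  rewrite -hE // indicE memNset // mulr0 addr0 /cut.
  case: ifP => _; first by rewrite subrr hs20 mulr_ge0 ?hs2_ge0.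
  by have := hs2_ge0 (f x - g x); lra.
rewrite indicE xS mulr1.
have bh : hs2 (h x) <= M by apply: NM; case: sh.
have bg : hs2 (g x) <= M by apply: NM; case: sg.
rewrite /cut; case: ifP => _.
  have := hs2_ge0 (f x - g x); rewrite sub0r hs2N; lra.
have -> : f x - h x = (f x - g x) + (g x - h x) by rewrite addrA subrK.
have := hs2D (f x - g x) (g x - h x); have := hs2B (g x) (h x); lra.
Qed.

(** Between [s] and [t] one of the cuts vanishes, and the other is controlled there by comparison
    with [g0], a bounded loop near [f] chosen before [d]; elsewhere the difference is 0 or
    [g - f]. *)
Lemma cut_continuous t f : L2N N f -> forall e : R, 0 < e ->
  exists2 d : R, 0 < d & forall s g, L2N N g -> `|s - t| < d ->
    L2dist g f < d -> L2dist (cut s g) (cut t f) < e.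
Proof.
move=> [Lf af] e e0; have [M M0 NM] := compact_hs2_bound cN.
have [g0 [sg0 fg0]] := af (e / 4) ltac:(lra).
have Lg0 := smooth_loop_L2 cN sg0.
(* The squared error is at most 2 (e/4)^2 + 4 (e/4)^2 + 4 M d, whose last term is at most e^2/4. *)
pose d := Num.min (e / 4) (e ^+ 2 / (16 * (M + 1))).
have e20 : 0 < e ^+ 2 by rewrite exprn_gt0.
have M1 : 0 < 16 * (M + 1) by lra.
have d0 : 0 < d by rewrite lt_min !divr_gt0.
have d1 : d <= e / 4 by rewrite ge_min lexx.
have d2 : 16 * (M + 1) * d <= e ^+ 2.
  by rewrite mulrC -ler_pdivlMr // ge_min lexx orbT.
exists d => // s g [Lg _] std gfd.
have {gfd} : L2dist g f < e / 4 by exact: lt_le_trans d1.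
move: fg0; rewrite !L2dist_lt //; [|lra..] => fg0 gf.
pose S := `[Num.min s t, Num.max s t]%classic : set R.
have mS : measurable (S : set R) by exact: measurable_itv.
have lS : (lebesgue_measure (S : set R) <= `|s - t|%:E)%E.
  rewrite lebesgue_measure_itv /= lte_fin; case: ifP => _; last by rewrite lee_fin.
  rewrite -EFinB lee_fin; have [st|ts] := leP s t.
    by rewrite distrC ger0_norm ?subr_ge0.
  by rewrite ger0_norm ?subr_ge0 // ltW.
have mB := fun (u v : R -> cmx R n) (Lu : L2 u) (Lv : L2 v) =>
  measurable_entriesB (L2_measurable Lu) (L2_measurable Lv).
have M4 : 0 <= 4 * M by rewrite mulr_ge0.
have [|_] := @fine_hs2_int_bound _ _ (fun x => cut s g x - cut t f x) _ _ 2 4 (4 * M)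
  `|s - t| S (mB _ _ (L2_cut s Lg) (L2_cut t Lf)) (mB _ _ Lg Lf) (mB _ _ Lf Lg0)
  (L2_sub_lty Lg Lf) (L2_sub_lty Lf Lg0) mS lS (ler0n _ 2) (ler0n _ 4) M4; last first.
  have : 4 * M * `|s - t| <= 4 * M * d by rewrite ler_wpM2l // ltW.
  move: fg0 gf; rewrite !expr_div_n; lra.
move=> x x01; rewrite /cut frac_id // indicE.
have bg : hs2 (g0 x) <= M by apply: NM; case: sg0.
(* Chaining this bound with the next one bounds [hs2 (g x)] and produces the coefficients 2, 4 and 4
   M used above. *)
have bf : hs2 (f x) <= 2 * hs2 (f x - g0 x) + 2 * M.
  have := hs2D (f x - g0 x) (g0 x); rewrite subrK; lra.
have bgf : hs2 (g x) <= 2 * hs2 (g x - f x) + 2 * hs2 (f x).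
  by have := hs2D (g x - f x) (f x); rewrite subrK.
have [p1 p2] := (hs2_ge0 (f x - g0 x), hs2_ge0 (g x - f x)).
have [xs|sx] := ltP x s; have [xt|tx] := ltP x t.
- by rewrite subrr hs20 !addr_ge0 // mulr_ge0.
- rewrite sub0r hs2N mem_set /= ?mulr1; first lra.
  by rewrite /S /= in_itv /= ge_min le_max tx (ltW xs) orbT.
- rewrite subr0 mem_set /= ?mulr1; first lra.
  by rewrite /S /= in_itv /= ge_min le_max sx (ltW xt) orbT.
- have : 0 <= 4 * M * (x \in S)%:R by rewrite mulr_ge0.
  lra.
Qed.

End Cutting.

Theorem theorem5 (R : realType) (n : nat) (N : set (cmx R n)) :
  (exists k : nat, smooth_submanifold k N) ->
  compact N -> connected N -> N 0 ->
  L2_contractible (L2N N).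
Proof.
move=> [k sub] cN conN N0.
have path0 : forall q, N q -> smooth_path N 0 q.
  apply: connected_smooth_path => //.
    by move=> q Nq; exact: submanifold_near_path sub Nq.
  by exists (fun=> 0); split=> // j; exact: Ck_cst.
exists (@cut R n), (fun=> 0); split.
- exact/L2N_loop/smooth_loop_cst.
- by move=> t f t01 Xf; exact: L2N_cut.
- by move=> f _; exact: cut0.
- by move=> f _; exact: cut1.
- move=> t f t01 Xf e e0.
  have [d d0 dE] := cut_continuous cN t Xf e0.
  by exists d => // s g _; exact: dE.
Qed.
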